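(* Suppose the choice functions $\mu_Y$ satisfy $(\mu*1)$: for all disjoint $Y',Y''\subseteq L$ and all $\Sigma'\subseteq\Pi_{Y'}$, $\Sigma''\subseteq\Pi_{Y''}$, $\ \mu_{Y'\cup Y''}(\Sigma'\times\Sigma'')=\mu_{Y'}(\Sigma')\times\mu_{Y''}(\Sigma'')$. Then the logic has semantical interpolation of the form $\varphi\mathrel{|\!\sim}\alpha\mathrel{|\!\sim}\psi$. That is: whenever $L=J\cup J'\cup J''$ is a disjoint union, $\varphi$ is a formula using only variables in $J\cup J'$, $\psi$ is a formula using only variables in $J'\cup J''$, and $\mu_L(M(\varphi))\subseteq M(\psi)$, there is $A'\subseteq\Pi_{J'}$ such that, for $A=\Pi_J\times A'\times\Pi_{J''}$, $$\mu_L(M(\varphi))\subseteq A\quad\text{and}\quad \mu_L(A)\subseteq M(\psi).$$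
   Context: Two-valued propositional logic with set of propositional variables $L$. For $Y\subseteq L$, $\Pi_Y=\{0,1\}^Y$ is the set of models of the sublanguage $Y$; for disjoint $Y',Y''$ we identify $\Pi_{Y'\cup Y''}$ with $\Pi_{Y'}\times\Pi_{Y''}$. $M(\varphi)\subseteq\Pi_L$ is the set of classical models of $\varphi$. For every $Y\subseteq L$ a choice function $\mu_Y:\mathcal P(\Pi_Y)\to\mathcal P(\Pi_Y)$ with $\mu_Y(A)\subseteq A$ is given ($\mu_Y(A)$ is thought of as the set of minimal models of $A$). The non-monotonic consequence relation is $\varphi\mathrel{|\!\sim}\psi$ iff $\mu_L(M(\varphi))\subseteq M(\psi)$; for a set $A\subseteq\Pi_L$ in place of a formula, $\varphi\mathrel{|\!\sim}A$ means $\mu_L(M(\varphi))\subseteq A$ and $A\mathrel{|\!\sim}\psi$ means $\mu_L(A)\subseteq M(\psi)$. The interpolant is only required to be a set of models, not to be definable by a formula. *)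

(* Defs.v *)
From mathcomp Require Import all_boot.
From mathcomp Require Import boolp classical_sets functions.

Set Implicit Arguments.
Unset Strict Implicit.
Unset Printing Implicit Defensive.

Local Open Scope classical_set_scope.

Inductive formula (L : Type) : Type :=
| Var of L
| Top
| Bot
| Neg of formula L
| And of formula L & formula L
| Or of formula L & formula L
| Imp of formula L & formula L.

Arguments Top {L}.
Arguments Bot {L}.

Fixpoint vars (L : Type) (phi : formula L) : set L :=
  match phi with
  | Var p => [set p]
  | Top | Bot => set0
  | Neg a => vars a
  | And a b | Or a b | Imp a b => vars a `|` vars b
  end.

Fixpoint eval (L : Type) (v : L -> bool) (phi : formula L) : bool :=
  match phi with
  | Var p => v p
  | Top => true
  | Bot => false
  | Neg a => ~~ eval v a
  | And a b => eval v a && eval v b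
  | Or a b => eval v a || eval v b
  | Imp a b => eval v a ==> eval v b
  end.

(* Pi_Y = {0,1}^Y: the domain is the subtype of the elements of Y. *)
Definition Pi (L : Type) (Y : set L) : Type := Y -> bool.

Definition restr (L : Type) (Y Z : set L) (YZ : Y `<=` Z) (m : Pi Z) : Pi Y :=
  m \o subfun YZ.

(* Pi_L is Pi [set: L]; to_setT is the bijection from L to the subtype
   of [set: L]. *)
Definition M (L : Type) (phi : formula L) : set (Pi [set: L]) :=
  [set m : Pi [set: L] | eval (m \o @to_setT L) phi].

Section Product.
Variables (L : Type) (Y' Y'' Y : set L) (E : Y' `|` Y'' = Y).

Lemma union_subl : Y' `<=` Y. Proof. by rewrite -E; exact: subsetUl. Qed.
Lemma union_subr : Y'' `<=` Y. Proof. by rewrite -E; exact: subsetUr. Qed.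

(* For disjoint Y', Y'' a model of Y' `|` Y'' is identified with the pair of its
   restrictions (see [restr_pair_bij]).  The union is called Y, with a proof of
   Y' `|` Y'' = Y, so that a product can be typed directly as a set of models
   of a given Y, for instance of [set: L]. *)
Definition restr_pair (m : Pi Y) : Pi Y' * Pi Y'' :=
  (restr union_subl m, restr union_subr m).

Definition prodPi (S' : set (Pi Y')) (S'' : set (Pi Y'')) : set (Pi Y) :=
  restr_pair @^-1` (S' `*` S'').

Lemma restr_pair_bij : Y' `&` Y'' = set0 -> bijective restr_pair.
Proof.
move=> dis.
pose glue (p : Pi Y' * Pi Y'') : Pi Y := fun y =>
  match pselect (Y' (val y)) with
  | left h => p.1 (SigSub (mem_set h))
  | right _ =>
    match pselect (Y'' (val y)) with
    | left h => p.2 (SigSub (mem_set h))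
    | right _ => false
    end
  end.
exists glue.
- move=> m; apply/funext => y; rewrite /glue.
  case: pselect => [h|nh]; first by congr (m _); exact/val_inj.
  case: pselect => [h|nh']; first by congr (m _); exact/val_inj.
  have YU x : Y x -> (Y' `|` Y'') x by rewrite E.
  by have [] := YU _ (set_valP y).
- move=> [m1 m2]; rewrite /restr_pair /glue; congr pair; apply/funext => y /=.
  + rewrite /restr /=; case: pselect => [h|nh].
      by congr (m1 _); exact/val_inj.
    by exfalso; apply: nh; exact: set_valP.
  + rewrite /restr /=; case: pselect => [h|nh].
      suff : set0 (val y) by [].
      have D0 x : Y' x -> Y'' x -> set0 x by rewrite -dis.
      exact: D0 h (set_valP y).
    case: pselect => [h|nh']; first by congr (m2 _); exact/val_inj.
    by exfalso; apply: nh'; exact: set_valP.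
Qed.

End Product.

Definition choice_functions (L : Type)
    (mu : forall Y : set L, set (Pi Y) -> set (Pi Y)) : Prop :=
  forall (Y : set L) (A : set (Pi Y)), mu Y A `<=` A.

Definition mu_star1 (L : Type)
    (mu : forall Y : set L, set (Pi Y) -> set (Pi Y)) : Prop :=
  forall (Y' Y'' : set L) (S' : set (Pi Y')) (S'' : set (Pi Y'')),
    Y' `&` Y'' = set0 ->
    mu (Y' `|` Y'') (prodPi erefl S' S'') = prodPi erefl (mu Y' S') (mu Y'' S'').

(* Main.v *)
Require Import Defs.
From mathcomp Require Import all_boot.
From mathcomp Require Import boolp classical_sets functions.
Local Open Scope classical_set_scope.

(** The interpolant [A'] is the projection to [J'] of the minimal models of
    [phi], so that [phi |~ A] holds by construction.  For [A |~ psi], compute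
    both sets of minimal models as products.  As [phi] says nothing about
    [J''], [M phi] is a cylinder over [J `|` J'] ([M_cylinder]), and
    [mu_star1] makes the [J'']-component of its minimal models range over the
    whole of [mu J'' setT], independently of the other component.  In the same
    way a minimal model [m] of [A] has its [J'']-component in [mu J'' setT],
    while its [J']-component is in [mu J' A'], hence in [A'], hence is the
    [J']-component of some minimal model [n] of [phi].  Replacing the
    [J'']-component of [n] by that of [m] therefore gives again a minimal model
    of [phi], which satisfies [psi] by hypothesis.  It agrees with [m] on
    [J' `|` J''], the only variables of [psi], so [m] satisfies [psi] too. *)

Lemma eval_agree {L : Type} (v w : L -> bool) (phi : formula L) :
  (forall p, vars phi p -> v p = w p) -> eval v phi = eval w phi.
Proof.
elim: phi => [p|||a IHa|a IHa b IHb|a IHa b IHb|a IHa b IHb] //= vw;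
  first exact: vw.
- by rewrite IHa.
- by rewrite IHa ?IHb // => p ap; apply: vw; [right|left].
- by rewrite IHa ?IHb // => p ap; apply: vw; [right|left].
- by rewrite IHa ?IHb // => p ap; apply: vw; [right|left].
Qed.

Lemma M_agree {L : Type} (phi : formula L) (m n : Pi [set: L]) :
  (forall p, vars phi p -> m (to_setT p) = n (to_setT p)) -> M phi m -> M phi n.
Proof. by rewrite /M /= => /eval_agree ->. Qed.

Lemma restr_agree {L : Type} {Y Z : set L} {YZ : Y `<=` Z} {m n : Pi Z} :
  restr YZ m = restr YZ n -> forall p : Z, Y (val p) -> m p = n p.
Proof.
move=> emn p Yp; have := congr1 (@^~ (SigSub (mem_set Yp))) emn.
by rewrite /restr /=; congr (m _ = n _); exact/val_inj.
Qed.

(** This is where the syntactic restriction on the variables of [phi] becomes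
    the product form to which [mu_star1] applies. *)
Lemma M_cylinder {L : Type} {Y' Y'' : set L} (E : Y' `|` Y'' = [set: L])
    (phi : formula L) :
  vars phi `<=` Y' ->
  M phi = prodPi E (restr (union_subl E) @` M phi) [set: Pi Y''].
Proof.
move=> phiY; apply/seteqP; split=> [m phim|m [[n phin nm] _]].
  by split=> //; exists m.
by apply: M_agree phin => p /phiY Yp; exact: (restr_agree nm).
Qed.

(** [mu_star1] speaks of the literal union only; a product typed over
    [[set: L]] needs it for any name [Y] of the union. *)
Lemma mu_star1_eq {L : Type} {mu : forall Y : set L, set (Pi Y) -> set (Pi Y)}
    {Y' Y'' Y : set L} (E : Y' `|` Y'' = Y) (S' : set (Pi Y'))
    (S'' : set (Pi Y'')) :
  mu_star1 mu -> Y' `&` Y'' = set0 ->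
  mu Y (prodPi E S' S'') = prodPi E (mu Y' S') (mu Y'' S'').
Proof. by case: Y / E => mu1; exact: mu1. Qed.

Theorem proposition5p3p5 (L : Type)
  (mu : forall Y : set L, set (Pi Y) -> set (Pi Y))
  (mu_sub : choice_functions mu)
  (mu1 : mu_star1 mu)
  (J J' J'' : set L)
  (disJJ' : J `&` J' = set0)
  (disJJ'' : J `&` J'' = set0)
  (disJ'J'' : J' `&` J'' = set0)
  (EL : (J `|` J') `|` J'' = [set: L])
  (phi psi : formula L)
  (phi_vars : vars phi `<=` J `|` J')
  (psi_vars : vars psi `<=` J' `|` J'')
  (phi_psi : mu [set: L] (M phi) `<=` M psi) :
  exists A' : set (Pi J'),
    let A : set (Pi [set: L]) :=
      prodPi EL (prodPi erefl [set: Pi J] A') [set: Pi J''] in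
    mu [set: L] (M phi) `<=` A /\ mu [set: L] A `<=` M psi.
Proof.
have dis : (J `|` J') `&` J'' = set0 by rewrite setIUl disJJ'' disJ'J'' setU0.
pose toJ' (m : Pi [set: L]) : Pi J' :=
  restr (union_subr (erefl (J `|` J'))) (restr (union_subl EL) m).
exists (toJ' @` mu [set: L] (M phi)) => A; split=> [m phim|m].
  by split=> //; split=> //; exists m.
rewrite /A (mu_star1_eq EL) // mu1 // => -[[_ /mu_sub[n phin nm]] mJ''].
have [glue _ glueK] := restr_pair_bij EL dis.
(* k is n with its J''-component replaced by that of m *)
pose k := glue (restr (union_subl EL) n, restr (union_subr EL) m).
have [kn km] : restr (union_subl EL) k = restr (union_subl EL) n /\
               restr (union_subr EL) k = restr (union_subr EL) m.
  by have [] := glueK (restr (union_subl EL) n, restr (union_subr EL) m).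
have phik : mu [set: L] (M phi) k.
  move: phin; rewrite (M_cylinder EL phi phi_vars) (mu_star1_eq EL) //.
  by move=> [nJJ' _]; split; rewrite /= ?kn ?km.
have kmJ' : toJ' k = toJ' m by rewrite /toJ' kn.
apply: M_agree (phi_psi _ phik) => p /psi_vars[J'p|J''p].
  have JJ'p : (J `|` J') p by right.
  have := restr_agree kmJ' (SigSub (mem_set JJ'p)) J'p.
  by rewrite /restr /=; congr (k _ = m _); exact/val_inj.
exact: (restr_agree km).
Qed.
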